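(* Consider the closed-loop inverter model $$\dot\xi=v_{dc}-v_{dc,\mathrm{ref}},$$ $$(C_{dc}+K_d)\dot v_{dc}=-G_{dc}v_{dc}+i_{dc,\mathrm{ref}}-K_p(v_{dc}-v_{dc,\mathrm{ref}})-K_i\xi-\tfrac{\mu}{2}\mathbf{e}_2^\top i_{dq},$$ $$L\,\dot i_{dq}=-(R\boldsymbol{I}+v_{dc}\eta L\boldsymbol{J})i_{dq}+\tfrac{\mu}{2}\mathbf{e}_2v_{dc}-v_{dq},$$ $$C\,\dot v_{dq}=-(G\boldsymbol{I}+v_{dc}\eta C\boldsymbol{J})v_{dq}-s_{l,dq}+i_{dq}.$$ Assume that the load disturbance $s_{l,dq}\in\mathbb{R}^2$ is a constant and measurable signal and that, for a given reference AC voltage $r_{\mathrm{ref}}>0$, $$\psi=r_{\mathrm{ref}}^2\,\lVert\mathcal{Z}\mathcal{Y}+\boldsymbol{I}\rVert^2-\lVert\mathcal{Z}s_{l,dq}\rVert^2>0.$$ Assign the modulation amplitude $$\mu=\mu_+(s_{l,dq}):=\frac b2+\sqrt{\Bigl(\frac b2\Bigr)^2+\frac{4\psi}{v_{dc,\mathrm{ref}}^2}},\qquad b=\frac{4}{v_{dc,\mathrm{ref}}}\,\mathbf{e}_2^\top\mathcal{Z}\,s_{l,dq}.$$ Further assume that $$\frac{C^2\lVert v_{dq}^*\rVert^2}{4G}+\frac{L^2\lVert i_{dq}^*\rVert^2}{4R}<\frac{G_{dc}}{\eta^2},$$ where $(\xi^*,v_{dc}^*,i_{dq}^*,v_{dq}^*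 )$ is the equilibrium of the closed loop. Then the unique equilibrium is characterized by $v_{dc}^*=v_{dc,\mathrm{ref}}$ and $\lVert v_{dq}^*\rVert=r_{\mathrm{ref}}$, and it is globally asymptotically stable for the closed loop.
   Context: Here $\boldsymbol{I}$ is the $2\times2$ identity, $\boldsymbol{J}=\begin{bmatrix}0&-1\\1&0\end{bmatrix}$, $\mathbf{e}_2=\begin{bmatrix}0\\1\end{bmatrix}$, $\lVert\cdot\rVert$ is the Euclidean norm for vectors and the induced norm for matrices, $\mathcal{Z}=R\boldsymbol{I}+\omega_0L\boldsymbol{J}$, $\mathcal{Y}=G\boldsymbol{I}+\omega_0C\boldsymbol{J}$, with $\omega_0>0$, $v_{dc,\mathrm{ref}}>0$ and $\eta=\omega_0/v_{dc,\mathrm{ref}}$. The parameters $C_{dc},G_{dc},L,R,C,G,K_p,K_i,K_d,i_{dc,\mathrm{ref}}>0$ are constants. The state is $(\xi,v_{dc},i_{dq},v_{dq})\in\mathbb{R}\times\mathbb{R}\times\mathbb{R}^2\times\mathbb{R}^2$. *)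

(* Defs.v *)
From HB Require Import structures.
From mathcomp Require Import all_boot all_order all_algebra.
From mathcomp Require Import all_classical all_reals all_analysis.
Set Implicit Arguments.
Unset Strict Implicit.
Unset Printing Implicit Defensive.
Import Order.TTheory GRing.Theory Num.Theory.
Import numFieldNormedType.Exports.
Local Open Scope classical_set_scope.
Local Open Scope ring_scope.

(* The library norm `|_| on vectors and matrices is the max norm, hence the
   next two definitions. *)
Definition euclid_norm (R : realType) (n : nat) (x : 'cV[R]_n) : R :=
  Num.sqrt (\sum_(i < n) x i 0 ^+ 2).

Definition induced_norm (R : realType) (m n : nat) (A : 'M[R]_(m, n)) : R :=
  sup [set euclid_norm (A *m x) | x in [set x : 'cV[R]_n | euclid_norm x <= 1]].

Section AutonomousSystems.
Context (R : realType) (V : normedModType R).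

(* [dyn x xdot] is an autonomous ordinary differential equation, possibly in
   implicit form. *)
Implicit Types (dyn : V -> V -> Prop) (x : R -> V).

Definition is_equilibrium dyn (xs : V) : Prop := dyn xs 0.

(* Solutions on the time interval [0, +oo[. The continuity requirement makes the
   value at time 0 the initial condition; the values at negative times are
   irrelevant. *)
Definition is_solution dyn x : Prop :=
  {within `[0, +oo[, continuous x} /\
  forall t : R, 0 < t -> exists2 xdot, is_derive t 1 x xdot & dyn (x t) xdot.

(* The first clause, existence of a trajectory for all nonnegative times from
   every initial state, prevents the other two from holding vacuously. On a
   finite-dimensional V the notion does not depend on the choice of norm. *)
Definition globally_asymptotically_stable dyn (xs : V) : Prop :=
  [/\ forall x0 : V, exists x, is_solution dyn x /\ x 0 = x0,
      forall e : R, 0 < e -> exists2 d : R, 0 < d &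
        forall x, is_solution dyn x -> `|x 0 - xs| < d ->
        forall t : R, 0 <= t -> `|x t - xs| < e
    & forall x, is_solution dyn x -> x t @[t --> +oo] --> xs].

End AutonomousSystems.

Record inverter (R : realType) := Inverter {
  C_dc : R;  C_dc_gt0 : 0 < C_dc;
  G_dc : R;  G_dc_gt0 : 0 < G_dc;
  L_ac : R;  L_ac_gt0 : 0 < L_ac;
  R_ac : R;  R_ac_gt0 : 0 < R_ac;
  C_ac : R;  C_ac_gt0 : 0 < C_ac;
  G_ac : R;  G_ac_gt0 : 0 < G_ac;
  K_p : R;  K_p_gt0 : 0 < K_p;
  K_i : R;  K_i_gt0 : 0 < K_i;
  K_d : R;  K_d_gt0 : 0 < K_d;
  i_dc_ref : R;  i_dc_ref_gt0 : 0 < i_dc_ref;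
  omega0 : R;  omega0_gt0 : 0 < omega0;
  v_dc_ref : R;  v_dc_ref_gt0 : 0 < v_dc_ref }.

Definition Jmx (R : realType) : 'M[R]_2 := delta_mx 1 0 - delta_mx 0 1.

Definition e2 (R : realType) : 'cV[R]_2 := delta_mx 1 0.

Section Inverter.
Context (R : realType) (P : inverter R).

Local Notation J := (Jmx R).
Local Notation e2 := (e2 R).

Definition eta : R := omega0 P / v_dc_ref P.

Definition Zmx : 'M[R]_2 := (R_ac P)%:M + (omega0 P * L_ac P) *: J.

Definition Ymx : 'M[R]_2 := (G_ac P)%:M + (omega0 P * C_ac P) *: J.

(* (xi, v_dc, i_dq, v_dq) *)
Definition state : Type := (R * R * 'cV[R]_2 * 'cV[R]_2)%type.

Definition closed_loop (mu : R) (s : 'cV[R]_2) (x xdot : state) : Prop :=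
  let: (xi, v_dc, i_dq, v_dq) := x in
  let: (dxi, dv_dc, di_dq, dv_dq) := xdot in
  [/\ dxi = v_dc - v_dc_ref P,
      (C_dc P + K_d P) * dv_dc =
        - G_dc P * v_dc + i_dc_ref P - K_p P * (v_dc - v_dc_ref P)
        - K_i P * xi - mu / 2 * (e2^T *m i_dq) 0 0,
      L_ac P *: di_dq =
        - (((R_ac P)%:M + (v_dc * eta * L_ac P) *: J) *m i_dq)
        + (mu / 2 * v_dc) *: e2 - v_dq
    & C_ac P *: dv_dq =
        - (((G_ac P)%:M + (v_dc * eta * C_ac P) *: J) *m v_dq) - s + i_dq].

Definition psi (r_ref : R) (s : 'cV[R]_2) : R :=
  r_ref ^+ 2 * induced_norm (Zmx *m Ymx + 1%:M) ^+ 2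
  - euclid_norm (Zmx *m s) ^+ 2.

Definition b_coef (s : 'cV[R]_2) : R :=
  4 / v_dc_ref P * (e2^T *m Zmx *m s) 0 0.

Definition mu_plus (r_ref : R) (s : 'cV[R]_2) : R :=
  b_coef s / 2
  + Num.sqrt ((b_coef s / 2) ^+ 2 + 4 * psi r_ref s / v_dc_ref P ^+ 2).

Definition damping_condition (x : state) : Prop :=
  let: (_, _, i_dq, v_dq) := x in
  C_ac P ^+ 2 * euclid_norm v_dq ^+ 2 / (4 * G_ac P)
  + L_ac P ^+ 2 * euclid_norm i_dq ^+ 2 / (4 * R_ac P)
  < G_dc P / eta ^+ 2.

End Inverter.

(* Main.v *)
Require Import Defs.
From HB Require Import structures.
From mathcomp Require Import all_boot all_order all_algebra.
From mathcomp Require Import all_classical all_reals all_analysis.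
From mathcomp Require Import ring lra.
Set Implicit Arguments.
Unset Strict Implicit.
Unset Printing Implicit Defensive.
Import Order.TTheory GRing.Theory Num.Theory.
Import numFieldNormedType.Exports.
Local Open Scope classical_set_scope.
Local Open Scope ring_scope.

(** Let [v] be the reference DC voltage and identify a plane vector with a
    complex number, so that [a I + b J] becomes multiplication by [a + i b].

    Equilibrium. The integrator forces [v_dc = v], and then the two AC
    equations say that the current is [Y v_dq + s] and that
    [(ZY + I) v_dq = (mu / 2) v e2 - Z s].  Since [psi > 0], the complex number
    [ZY + I] is nonzero, so this has exactly one solution; taking squared moduli,
    its norm is [r_ref] exactly when [mu] satisfies the quadratic equation of
    which [mu_plus] is the larger root ([mu_plus_quadratic],
    [exists_equilibrium], [equilibrium_unique]).

    Stability. In the deviation [a] from the equilibrium the only nonlinear terms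
    rotate the AC deviations, and a rotation does no work: the stored energy
    [sum_j q_j a_j ^ 2 / 2], where the weights are [K_i], [C_dc + K_d], [L] and
    [C], has a rate that is a quadratic form in [a].  The damping condition is
    what makes this form negative definite in all the directions but that of the
    integrator state ([energy_rate_le]).  Instead of an invariance principle, a
    small multiple of the product of the integrator and DC voltage deviations is
    added to the energy; the result is a strict Lyapunov function
    ([exists_strict_lyapunov]), so that deviations decay exponentially
    ([error_decay]), which gives both stability and attractivity.

    Existence of trajectories. Picard iteration with an exponentially weighted
    distance gives global solutions for globally Lipschitz fields
    ([lipschitz_global_solution]).  The error field [f] is only Lipschitz on
    bounded sets, so it is first composed with the radial retraction [rho] onto a
    large ball.  As [rho x] is a positive multiple of [x], the energy still
    decreases along [f \o rho]; its solution never leaves the ball and therefore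
    solves the original equation ([dissipative_global_solution]). *)

(** * Calculus on the half-line *)

Section OneVariable.
Context (R : realType).
Implicit Types (f g G H h : R -> R) (t : R).

Lemma le_of_derive_ge0 f f' : {within `[0, +oo[, continuous f} ->
  (forall t, 0 < t -> is_derive t 1 f (f' t)) ->
  (forall t, 0 < t -> 0 <= f' t) ->
  forall t, 0 <= t -> f 0 <= f t.
Proof.
move=> fc fd f0 t t0.
apply: (@ger0_derive1_ndecry R f 0) => // x; rewrite ?in_itv/= ?andbT.
- by move=> /fd [].
- by move=> x0; rewrite derive1E; have [_ ->] := fd _ x0; exact: f0.
Qed.

Lemma is_derive_cvg f t d : is_derive t 1 f d -> {for t, continuous f}.
Proof. by case=> /derivable1_diffP/differentiable_continuous. Qed.

Lemma within_continuous_of_derive f f' :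
  (forall t, 0 <= t -> is_derive t 1 f (f' t)) ->
  {within `[0, +oo[, continuous f}.
Proof.
move=> fd; apply: continuous_in_subspaceT => t; rewrite inE/= in_itv/= andbT.
by move=> /fd /is_derive_cvg.
Qed.

(** A mean value inequality: it bounds integrals by integrals throughout, with
    derivatives standing for the integrands. *)
Lemma norm_increment_le G g H h :
  (forall t, 0 <= t -> is_derive t 1 G (g t)) ->
  (forall t, 0 <= t -> is_derive t 1 H (h t)) ->
  (forall t, 0 <= t -> `|g t| <= h t) ->
  forall t, 0 <= t -> `|G t - G 0| <= H t - H 0.
Proof.
move=> dG dH gh t t0.
have step (c : R) : `|c| = 1 -> c * (G t - G 0) <= H t - H 0.
  move=> c1; pose f : R -> R := H - c \*: G.
  have df (s : R) : 0 <= s -> is_derive s 1 f (h s - c * g s).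
    by move=> s0; have ? := dG s s0; have ? := dH s s0; exact: is_deriveB.
  have := @le_of_derive_ge0 f (fun s => h s - c * g s)
    (within_continuous_of_derive df) (fun s s0 => df s (ltW s0)) _ t t0.
  rewrite /f !fctE => f0t; suff : H 0 - c * G 0 <= H t - c * G t by lra.
  apply: f0t => s s0; rewrite subr_ge0 (le_trans (ler_norm _))// normrM c1 mul1r.
  exact: gh (ltW s0).
have := step 1; have := step (-1).
rewrite normrN normr1 => /(_ erefl) ? /(_ erefl) ?; rewrite ler_norml; lra.
Qed.

Lemma within_continuousD (A : set R) (f g : R -> R) :
  {within A, continuous f} -> {within A, continuous g} ->
  {within A, continuous (fun t => f t + g t)}.
Proof. by move=> fc gc t; exact: continuousD (fc t) (gc t). Qed.

Lemma within_continuousM (A : set R) (f g : R -> R) :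
  {within A, continuous f} -> {within A, continuous g} ->
  {within A, continuous (fun t => f t * g t)}.
Proof. by move=> fc gc t; exact: continuousM (fc t) (gc t). Qed.

Lemma within_continuous_sum (I : finType) (A : set R) (u : R -> I -> R) :
  (forall j, {within A, continuous (fun t => u t j)}) ->
  {within A, continuous (fun t => \sum_j u t j)}.
Proof.
move=> uc; elim: (index_enum I) => [|j r IH].
  under eq_fun do rewrite big_nil.
  exact/continuous_subspaceT/cst_continuous.
by under eq_fun do rewrite big_cons; exact: within_continuousD.
Qed.

Lemma is_derive_sum_fin (I : finType) (u : R -> I -> R) (du : I -> R) (t : R) :
  (forall j, is_derive t 1 (fun s => u s j) (du j)) ->
  is_derive t 1 (fun s => \sum_j u s j) (\sum_j du j).
Proof.
move=> dudu; elim: (index_enum I) => [|j r IH].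
  under eq_fun do rewrite big_nil.
  rewrite big_nil; exact: is_derive_cst.
under eq_fun do rewrite big_cons.
by rewrite big_cons; exact: is_deriveD.
Qed.

Lemma is_derive_expMr (c k t : R) :
  is_derive t 1 (fun s => c * expR (k * s)) (k * c * expR (k * t)).
Proof.
have dk : is_derive t 1 (fun s : R => k * s) k.
  by have := is_deriveZ k (is_derive_id t (1:R)); rewrite /GRing.scale/= mulr1.
have de : is_derive t 1 (expR \o (fun s : R => k * s)) (k * expR (k * t)).
  by apply: is_derive_eq; rewrite mulrC.
have := is_deriveZ c de; rewrite /GRing.scale/= mulrCA mulrA.
exact.
Qed.

(** Gronwall's inequality: [v t * expR (k * t)] is nonincreasing. *)
Lemma exponential_decay (v v' : R -> R) (k : R) :
  {within `[0, +oo[, continuous v} ->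
  (forall t : R, 0 < t -> is_derive t 1 v (v' t)) ->
  (forall t : R, 0 < t -> v' t <= - k * v t) ->
  forall t : R, 0 <= t -> v t <= v 0 * expR (- k * t).
Proof.
move=> vc dv v'k t t0.
pose E := fun s : R => expR (k * s).
have dE (s : R) : is_derive s 1 E (k * E s).
  have := is_derive_expMr 1 k s; rewrite mulr1.
  by under eq_fun do rewrite mul1r.
have vEc : {within `[0, +oo[, continuous (- (v * E))}.
  have Ec : {within `[0, +oo[, continuous E}.
    by apply: continuous_subspaceT => s; have /is_derive_cvg := dE s.
  by move=> s; apply: continuousN; apply: continuousM; [exact: vc | exact: Ec].
have dvE (s : R) : 0 < s ->
    is_derive s 1 (- (v * E)) (- (v s * (k * E s) + E s * v' s)).
  by move=> s0; have ? := dv s s0; have ? := dE s; exact: is_deriveN.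
have := le_of_derive_ge0 vEc dvE _ t0.
rewrite !fctE lerN2 /E mulr0 expR0 mulr1 mulNr expRN => vE.
rewrite ler_pdivlMr ?expR_gt0//; apply: vE => s.
move=> s0; rewrite oppr_ge0 mulrCA mulrC -/(E s).
  have := v'k s s0; have : 0 < E s by exact: expR_gt0.
  nra.
Qed.

(** The difference of the two sides is [k * (x - y / (2 * k)) ^+ 2]. *)
Lemma young (k x y : R) : 0 < k -> y * x <= k * x ^+ 2 + y ^+ 2 / (4 * k).
Proof.
move=> k0; rewrite -subr_ge0.
have -> : k * x ^+ 2 + y ^+ 2 / (4 * k) - y * x = k * (x - y / (2 * k)) ^+ 2.
  by field; rewrite gt_eqF.
by rewrite mulr_ge0 ?sqr_ge0 ?ltW.
Qed.

(** The integral is started at [-1] and [g] is frozen at [g 0] for negative times,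
    so that the two-sided derivative exists at [0] as well, while only the values
    of [g] on the half-line matter. *)
Definition primitive g t : R :=
  \int[lebesgue_measure]_(s in `[-1, t]) g (Num.max 0 s)
  - \int[lebesgue_measure]_(s in `[-1, 0]) g (Num.max 0 s).

Lemma primitive0 g : primitive g 0 = 0.
Proof. by rewrite /primitive subrr. Qed.

Lemma is_derive_primitive g : continuous (fun s : R => g (Num.max 0 s)) ->
  forall t, 0 <= t -> is_derive t 1 (primitive g) (g t).
Proof.
move=> gc t t0.
have [] := @continuous_FTC1_closed R (fun s => g (Num.max 0 s)) (-1) t (t + 1).
- by rewrite ltrDl.
- apply: continuous_compact_integrable; first exact: segment_compact.
  exact: continuous_subspaceT.
- by rewrite (lt_le_trans _ t0)// ltrN10.
- exact: gc.
set G := (fun x : R => _) => dG G't.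
have dGt : is_derive t 1 G (g t).
  by split=> //; rewrite -derive1E G't max_r.
have -> : primitive g = G - cst (G 0) by [].
by rewrite -[g t]subr0; exact: is_deriveB.
Qed.

Lemma continuous_max0 g : (forall t, 0 <= t -> {for t, continuous g}) ->
  continuous (fun s : R => g (Num.max 0 s)).
Proof.
move=> gc s; apply: continuous_comp; last by apply: gc; rewrite le_max lexx.
by apply: continuous_max; [exact: cst_continuous | exact: id].
Qed.

(** A sequence with geometrically small increments is Cauchy, and its tail is
    bounded by the sum of the increments that remain. *)
Lemma geometric_increments_cvg (u : nat -> R) (a : R) : 0 <= a ->
  (forall n, `|u n.+1 - u n| <= a / 2 ^+ n) ->
  cvgn u /\ forall n, `|limn u - u n| <= 2 * a / 2 ^+ n.
Proof.
move=> a0 ua.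
have um n k : `|u (n + k)%N - u n| <= 2 * a / 2 ^+ n.
  suff : `|u (n + k)%N - u n| <= 2 * a / 2 ^+ n - 2 * a / 2 ^+ (n + k).
    by move=> /le_trans; apply; rewrite gerBl divr_ge0// ?mulr_ge0.
  elim: k => [|k IH]; first by rewrite addn0 !subrr normr0.
  rewrite addnS -(subrKA (u (n + k)%N)) (le_trans (ler_normD _ _))//.
  have := ua (n + k)%N; move: IH; rewrite exprS invfM.
  by set p := (2 ^+ n)^-1; set q := (2 ^+ (n + k))^-1; lra.
have uc : cvgn u.
  apply: cauchy_cvg; apply: cauchy_exP => e e0.
  have := @cvg_geometric R (2 * a) 2^-1.
  rewrite ger0_norm ?invr_ge0// invf_lt1// ltr1n => /(_ isT).
  move=> /cvgr0Pnorm_lt /(_ e e0) [N _ /(_ N (leqnn N)) Ne].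
  exists (u N); exists N => // n /= Nn; rewrite -(subnKC Nn).
  rewrite /ball/= distrC (le_lt_trans (um _ _))//.
  by rewrite (le_lt_trans _ Ne)// -exprVn ler_norm.
split=> // n.
have uncvg : (fun m => `|u m - u n|) @ \oo --> `|limn u - u n|.
  by apply: cvg_norm; apply: cvgB; [exact: uc | exact: cvg_cst].
apply: (cvgr_to_le uncvg).
by exists n => // m /= nm; rewrite -(subnKC nm).
Qed.

End OneVariable.

(** * Picard iteration for globally Lipschitz fields *)

Section Picard.
Context (R : realType) (I : finType).
Implicit Types (x y : R -> I -> R) (F : (I -> R) -> I -> R).

(** Continuity of [x] on the half-line, in the form that [primitive] consumes. *)
Definition future_continuous x :=
  forall j, continuous (fun s : R => x (Num.max 0 s) j).

Lemma future_continuous_comp F (K : R) x : 0 < K ->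
  (forall a b (d : R), (forall j, `|a j - b j| <= d) ->
    forall i, `|F a i - F b i| <= K * d) ->
  future_continuous x -> future_continuous (fun s => F (x s)).
Proof.
move=> K0 FK xc i t; apply/cvgrPdist_le => e e0.
have := @filter_forall _ _
  (fun j s => `|x (Num.max 0 t) j - x (Num.max 0 s) j| <= e / K) _ (nbhs_filter t).
have step j : \forall s \near t, `|x (Num.max 0 t) j - x (Num.max 0 s) j| <= e / K.
  by move/cvgrPdist_le : (xc j t); apply; rewrite divr_gt0.
move=> /(_ step).
apply: filterS => s /FK /(_ i) /le_trans; apply.
by rewrite mulrC divfK ?gt_eqF.
Qed.

Definition picard_step F (x0 : I -> R) x : R -> I -> R :=
  fun t j => x0 j + primitive (fun s => F (x s) j) t.

Fixpoint picard F (x0 : I -> R) n : R -> I -> R :=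
  if n is n'.+1 then picard_step F x0 (picard F x0 n') else fun=> x0.

Lemma is_derive_picard_step F (x0 : I -> R) x :
  future_continuous (fun s => F (x s)) -> forall (t : R) j, 0 <= t ->
  is_derive t 1 (fun s => picard_step F x0 x s j) (F (x t) j).
Proof.
move=> Fxc t j t0; rewrite -[F _ _]add0r.
by have := @is_derive_primitive _ (fun s => F (x s) j) (Fxc j) t t0; exact: is_deriveD.
Qed.

Lemma future_continuous_picard_step F (x0 : I -> R) x :
  future_continuous (fun s => F (x s)) -> future_continuous (picard_step F x0 x).
Proof.
move=> Fxc j; apply: (@continuous_max0 _ (fun s => picard_step F x0 x s j)) => t t0.
exact: is_derive_cvg (is_derive_picard_step _ Fxc _ t0).
Qed.

(** The Lipschitz hypothesis is stated for the sup distance, through its upper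
    bounds [d].  With respect to the weight [expR (2 * K * t)], whose growth rate is
    twice the Lipschitz constant, each Picard step halves distances on the whole
    half-line at once, so no local solutions have to be glued. *)
Theorem lipschitz_global_solution F (K : R) (x0 : I -> R) : 0 < K ->
  (forall a b (d : R), (forall j, `|a j - b j| <= d) ->
    forall i, `|F a i - F b i| <= K * d) ->
  exists x : R -> I -> R, x 0 = x0 /\
    forall (t : R) j, 0 <= t -> is_derive t 1 (fun s => x s j) (F (x t) j).
Proof.
move=> K0 FK.
pose X := picard F x0.
have Xc n : future_continuous (X n).
  elim: n => [j|n IH]; first exact: cst_continuous.
  exact/future_continuous_picard_step/future_continuous_comp/IH/FK.
have FXc n : future_continuous (fun s => F (X n s)).
  exact/future_continuous_comp/Xc/FK.
pose B : R := (\sum_i `|F x0 i|) / (2 * K).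
have B0 : 0 <= B by rewrite divr_ge0 ?sumr_ge0// mulr_ge0// ltW.
pose w (t : R) : R := B * expR (2 * K * t).
have w0 t : 0 <= w t by rewrite mulr_ge0// expR_ge0.
have w'E (c t : R) : is_derive t 1 (fun s : R => c * w s) (2 * K * c * w t).
  have -> : (fun s : R => c * w s) = fun s => c * B * expR (2 * K * s).
    by apply/funext => s; rewrite /w mulrA.
  by rewrite /w mulrA -[_ * c * B]mulrA; exact: is_derive_expMr.
have step (c : R) x y : 0 <= c ->
    (forall (t : R) j, 0 <= t -> `|x t j - y t j| <= c * w t) ->
    future_continuous x -> future_continuous y -> forall (t : R) j, 0 <= t ->
    `|picard_step F x0 x t j - picard_step F x0 y t j| <= c / 2 * w t.
  move=> c0 xy xc yc t j t0.
  have Fxc := future_continuous_comp K0 FK xc.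
  have Fyc := future_continuous_comp K0 FK yc.
  pose G : R -> R :=
    (fun s => picard_step F x0 x s j) - (fun s => picard_step F x0 y s j).
  have dG (s : R) : 0 <= s -> is_derive s 1 G (F (x s) j - F (y s) j).
    move=> s0; have ? := is_derive_picard_step x0 Fxc j s0.
    by have ? := is_derive_picard_step x0 Fyc j s0; exact: is_deriveB.
  have := norm_increment_le dG (fun s _ => w'E (c / 2) s) _ t0.
  rewrite /G !fctE /picard_step !primitive0 subrr subr0 -/(picard_step F x0 _ _ _).
  move=> Gle; apply: le_trans (Gle _) _ => [s s0|].
    rewrite (le_trans (FK _ _ (c * w s) _ j))//; first by move=> k; exact: xy.
    by rewrite le_eqVlt; apply/orP; left; apply/eqP; field.
  by rewrite gerBl mulr_ge0 ?divr_ge0.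
have Xstep n (t : R) j : 0 <= t -> `|X n.+1 t j - X n t j| <= (2 ^+ n)^-1 * w t.
  elim: n t j => [|n IH] t j t0; last first.
    rewrite exprSr invfM; exact: (step _ _ _ _ IH (Xc n.+1) (Xc n)).
  have := norm_increment_le (fun s => is_derive_picard_step x0 (FXc 0%N) j (t:=s))
    (fun s _ => w'E 1 s) _ t0.
  have -> : picard_step F x0 (X 0%N) 0 j = x0 j by rewrite /picard_step primitive0 addr0.
  move=> Gle.
  rewrite expr0 invr1; apply: le_trans (Gle _) _ => [s s0|].
    rewrite /X/= (@le_trans _ _ (\sum_i `|F x0 i|))//.
      by rewrite (bigD1 j)//= lerDl sumr_ge0.
    rewrite mulr1 mulrA /B [2 * K * _]mulrC divfK ?mulf_neq0 ?gt_eqF//.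
    rewrite ler_peMr ?sumr_ge0// -expR0 ler_expR mulr_ge0// mulr_ge0// ltW//.
  by rewrite gerBl mulr_ge0.
pose x (t : R) j := limn (fun n => X n t j).
have Xcvg (t : R) j : 0 <= t -> cvgn (fun n => X n t j) /\
    forall n, `|x t j - X n t j| <= 2 * w t / 2 ^+ n.
  by move=> t0; apply: geometric_increments_cvg => // n; rewrite mulrC; exact: Xstep.
have Xx n (t : R) j : 0 <= t -> `|x t j - X n t j| <= 2 / 2 ^+ n * w t.
  by move=> t0; rewrite mulrAC; exact: (Xcvg t j t0).2.
have small (t e : R) : 0 < e -> exists n, 2 / 2 ^+ n * w t < e.
  move=> e0; have := @cvg_geometric R (2 * w t) 2^-1.
  rewrite ger0_norm ?invr_ge0// invf_lt1// ltr1n => /(_ isT).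
  move=> /cvgr0Pnorm_lt /(_ e e0) [N _ /(_ N (leqnn N)) Ne]; exists N.
  by rewrite mulrAC (le_lt_trans _ Ne)// -exprVn ler_norm.
have xc : future_continuous x.
  move=> j t; apply/cvgrPdist_lt => e e0.
  have e3 : 0 < e / 3 by rewrite divr_gt0.
  have [n ne] := small (`|t| + 1) (e / 3) e3.
  have near_x (s : R) : Num.max 0 s <= `|t| + 1 ->
      `|x (Num.max 0 s) j - X n (Num.max 0 s) j| < e / 3.
    move=> st; apply: le_lt_trans (Xx n _ j _) _; first by rewrite le_max lexx.
    apply: le_lt_trans ne; rewrite ler_wpM2l ?divr_ge0 ?exprn_ge0//.
    by rewrite ler_wpM2l// ler_expR ler_wpM2l// mulr_ge0// ltW.
  near=> s.
  have h1 : `|x (Num.max 0 t) j - X n (Num.max 0 t) j| < e / 3.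
    by apply: near_x; rewrite ge_max addr_ge0//= (le_trans (ler_norm t))// lerDl.
  have h2 : `|x (Num.max 0 s) j - X n (Num.max 0 s) j| < e / 3.
    apply: near_x; rewrite ge_max addr_ge0//=; near: s.
    apply: (@cvgr_le _ _ _ _ id t) => //.
    by rewrite (le_lt_trans (ler_norm t))// ltrDl.
  have h3 : `|X n (Num.max 0 t) j - X n (Num.max 0 s) j| < e / 3.
    near: s; by move/cvgrPdist_lt : (Xc n j t); apply.
  by move: h1 h2 h3; rewrite !ltr_norml => /andP[? ?] /andP[? ?] /andP[? ?]; lra.
pose y := picard_step F x0 x.
(* Both are limits of the iterates, hence x is a fixed point of the Picard step
   on the half-line; y is the version differentiable at 0 on both sides. *)
have xy (t : R) : 0 <= t -> x t = y t.
  move=> t0; apply/funext => j; apply/eqP; rewrite -subr_eq0 -normr_le0.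
  apply/ler_addgt0Pl => e e0; rewrite addr0.
  have [n ne] := small t e e0.
  have h1 : `|x t j - X n.+1 t j| <= 1 / 2 ^+ n * w t.
    rewrite (le_trans (Xx _ _ _ t0))// exprS le_eqVlt; apply/orP; left; apply/eqP.
    by field; rewrite gt_eqF// exprn_gt0.
  have h2 : `|y t j - X n.+1 t j| <= 1 / 2 ^+ n * w t.
    rewrite (_ : 1 / 2 ^+ n = 2 / 2 ^+ n / 2); last by field; rewrite gt_eqF// exprn_gt0.
    apply: step t0 => // [t' j' t'0]; exact: Xx.
  move: h1 h2 ne; rewrite !ler_norml; set p := (2 ^+ n)^-1.
  by move=> /andP[? ?] /andP[? ?] ?; apply/andP; split; lra.
exists y; split; first by apply/funext=> j; rewrite /y /picard_step primitive0 addr0.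
move=> t j t0; rewrite -xy//; apply: is_derive_picard_step => //.
exact/future_continuous_comp/xc/FK.
Unshelve. all: by end_near. Qed.

End Picard.

(** * Global solutions of dissipative systems *)

Section Dissipative.
Context (R : realType) (I : finType).
Implicit Types (a b : I -> R) (g h : (I -> R) -> R) (f : (I -> R) -> I -> R).

Definition lipschitz_on_boxes g := forall M : R, exists K : R,
  forall a b (d : R), (forall j, `|a j| <= M) -> (forall j, `|b j| <= M) ->
  (forall j, `|a j - b j| <= d) -> `|g a - g b| <= K * d.

Lemma lipschitz_on_boxes_cst (c : R) : lipschitz_on_boxes (fun=> c).
Proof. by move=> M; exists 0 => a b d _ _ _; rewrite subrr normr0 mul0r. Qed.

Lemma lipschitz_on_boxes_coord (j : I) : lipschitz_on_boxes (fun a => a j).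
Proof. by move=> M; exists 1 => a b d _ _ abd; rewrite mul1r. Qed.

Lemma lipschitz_on_boxesD g h : lipschitz_on_boxes g -> lipschitz_on_boxes h ->
  lipschitz_on_boxes (fun a => g a + h a).
Proof.
move=> gL hL M; have [K gK] := gL M; have [L hK] := hL M.
exists (K + L) => a b d aM bM abd.
rewrite opprD addrACA mulrDl (le_trans (ler_normD _ _))//.
by rewrite lerD ?gK ?hK.
Qed.

Lemma lipschitz_on_boxesM g h : lipschitz_on_boxes g -> lipschitz_on_boxes h ->
  lipschitz_on_boxes (fun a => g a * h a).
Proof.
have bnd g' : lipschitz_on_boxes g' -> forall M : R, exists B : R,
    forall a, (forall j, `|a j| <= M) -> `|g' a| <= B.
  move=> gL M; have [K gK] := gL `|M|; exists (`|g' (fun=> 0)| + K * `|M|) => a aM.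
  rewrite -[g' a](subrK (g' (fun=> 0))) addrC (le_trans (ler_normD _ _))// lerD2l.
  have aM' j : `|a j| <= `|M| by rewrite (le_trans (aM j))// ler_norm.
  by apply: gK => // j; rewrite ?normr0 ?subr0.
move=> gL hL M; have [K gK] := gL M; have [L hK] := hL M.
have [B gB] := bnd _ gL M; have [C hC] := bnd _ hL M.
exists (B * L + C * K) => a b d aM bM abd.
have -> : g a * h a - g b * h b = g a * (h a - h b) + h b * (g a - g b) by ring.
rewrite mulrDl (le_trans (ler_normD _ _))// !normrM -!mulrA.
by rewrite lerD// ler_pM// ?gB ?hC ?gK ?hK.
Qed.

(** The radial retraction onto the ball of radius [M] of the l1 norm.  All that the
    energy argument needs is that it scales [a] by a positive factor. *)
Definition retraction (M : R) a : I -> R :=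
  fun j => M / Num.max M (\sum_k `|a k|) * a j.

Lemma retraction_id (M : R) a : 0 < M -> \sum_k `|a k| <= M -> retraction M a = a.
Proof.
move=> M0 aM; apply/funext => j.
by rewrite /retraction max_l// divff ?mul1r// gt_eqF.
Qed.

Lemma retraction_le (M : R) a j : 0 < M -> `|retraction M a j| <= M.
Proof.
move=> M0; rewrite /retraction; set m := Num.max _ _.
have m0 : 0 < m by rewrite lt_max M0.
rewrite mulrAC normrM [`|m^-1|]ger0_norm ?invr_ge0 ?(ltW m0)// ler_pdivrMr//.
rewrite normrM gtr0_norm// ler_wpM2l ?(ltW M0)// le_max (bigD1 j)//= lerDl.
by rewrite sumr_ge0 ?orbT.
Qed.

(** With [p] and [q] the denominators, the difference is
    [M / p * (a j - b j) + M / p * (b j / q) * (q - p)], where all the factors in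
    front of the differences are at most [1]. *)
Lemma retraction_lipschitz (M : R) a b (d : R) : 0 < M ->
  (forall j, `|a j - b j| <= d) ->
  forall j, `|retraction M a j - retraction M b j| <= (1 + #|I|%:R) * d.
Proof.
move=> M0 abd j; rewrite /retraction.
set na := \sum_k `|a k|; set nb := \sum_k `|b k|.
set p := Num.max M na; set q := Num.max M nb.
have p0 : 0 < p by rewrite lt_max M0.
have q0 : 0 < q by rewrite lt_max M0.
have d0 : 0 <= d by rewrite (le_trans _ (abd j)).
have nab : `|na - nb| <= #|I|%:R * d.
  rewrite -sumrB (le_trans (ler_norm_sum _ _ _))//.
  rewrite mulr_natl -sumr_const ler_sum// => k _.
  by rewrite (le_trans (ler_dist_dist _ _)).
have pq : `|q - p| <= #|I|%:R * d.
  apply: le_trans nab; rewrite ler_norml /p /q.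
  have := ler_norm (na - nb); have := ler_norm (nb - na); rewrite [`|nb - _|]distrC.
  by rewrite !maxEle; case: ifP; case: ifP; lra.
have Mp : `|M / p| <= 1.
  by rewrite ger0_norm ?divr_ge0 ?(ltW M0) ?(ltW p0)// ler_pdivrMr// mul1r le_max lexx.
have bq : `|b j / q| <= 1.
  rewrite normrM [`|q^-1|]ger0_norm ?invr_ge0 ?(ltW q0)// ler_pdivrMr// mul1r le_max.
  by rewrite /nb (bigD1 j)//= lerDl sumr_ge0 ?orbT.
have -> : M / p * a j - M / q * b j
    = M / p * (a j - b j) + M / p * (b j / q) * (q - p).
  by field; rewrite !gt_eqF.
rewrite mulrDl mul1r (le_trans (ler_normD _ _))// !normrM.
rewrite lerD//.
  by rewrite (le_trans _ (abd j))// ler_piMl// -normrM.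
rewrite (le_trans _ pq)// ler_piMl// -!normrM normrM.
by rewrite -[leRHS]mulr1 ler_pM.
Qed.

(** A quadratic energy that does not increase confines trajectories to a ball;
    outside of it the field may be changed at will, and composing it with the
    retraction makes it globally Lipschitz without spoiling the dissipation. *)
Theorem dissipative_global_solution f (q x0 : I -> R) :
  (forall j, 0 < q j) ->
  (forall i, lipschitz_on_boxes (fun a => f a i)) ->
  (forall a, \sum_j q j * a j * f a j <= 0) ->
  exists x : R -> I -> R, x 0 = x0 /\
    forall (t : R) j, 0 <= t -> is_derive t 1 (fun s => x s j) (f (x t) j).
Proof.
move=> q0 fL fV.
pose E : R := \sum_j q j * x0 j ^+ 2.
have E0 : 0 <= E by rewrite sumr_ge0// => j _; rewrite mulr_ge0 ?sqr_ge0 ?(ltW (q0 _)).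
(* On the energy sublevel E, a coordinate satisfies a_j ^ 2 <= r with r = E / q_j,
   hence |a_j| <= r + 1. *)
pose M := 1 + \sum_j (E / q j + 1).
have M0 : 0 < M.
  by rewrite ltr_pwDl// sumr_ge0// => j _; rewrite addr_ge0// divr_ge0// ltW.
have [K KP] := choice (fun i => fL i M).
pose k := 1 + \sum_i `|K i|.
have k0 : 0 < k by rewrite ltr_pwDl// sumr_ge0.
have N0 : 0 < 1 + #|I|%:R :> R by rewrite ltr_pwDl.
have FL a b (d : R) : (forall j, `|a j - b j| <= d) -> forall i,
    `|f (retraction M a) i - f (retraction M b) i| <= (k * (1 + #|I|%:R)) * d.
  move=> abd i; have d0 : 0 <= d by rewrite (le_trans _ (abd i)).
  have := KP i _ _ _ (fun j => retraction_le a j M0) (fun j => retraction_le b j M0)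
    (retraction_lipschitz M0 abd).
  move=> /le_trans; apply; rewrite -mulrA ler_wpM2r ?mulr_ge0 ?(ltW N0)//.
  rewrite (le_trans (ler_norm _))// /k (bigD1 i)//=.
  by rewrite [leRHS]addrCA lerDl addr_ge0// sumr_ge0.
have [x [x00 dx]] := lipschitz_global_solution x0 (mulr_gt0 k0 N0) FL.
have xV (t : R) : 0 <= t -> \sum_j q j * x t j ^+ 2 <= E.
  move=> t0.
  pose V' s := \sum_j (- (2 * (q j * x s j * f (retraction M (x s)) j))).
  have dV (s : R) : 0 <= s ->
      is_derive s 1 (fun s => \sum_j (- (q j * x s j ^+ 2))) (V' s).
    move=> s0; apply: is_derive_sum_fin => j; have := dx s j s0.
    set y := fun s => x s j => dy.
    have -> : (fun s => - (q j * x s j ^+ 2)) = - (q j \*: (y ^+ 2)) by [].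
    apply: is_derive_eq; rewrite /GRing.scale/= /y; ring.
  have := @le_of_derive_ge0 _ _ V' (within_continuous_of_derive dV)
    (fun s s0 => dV s (ltW s0)) _ t t0.
  rewrite x00 !sumrN lerN2; apply => s s0.
  rewrite /V' sumrN -mulr_sumr oppr_ge0.
  set m := Num.max M (\sum_k `|x s k|).
  have m0 : 0 < m by rewrite lt_max M0.
  have := fV (retraction M (x s)).
  under eq_bigr => j _ do rewrite /retraction -/m mulrCA -mulrA.
  by rewrite -mulr_sumr pmulr_rle0 ?divr_gt0// => ?; rewrite pmulr_rle0.
exists x; split=> // t j t0.
suff xM : \sum_i `|x t i| <= M by have := dx t j t0; rewrite retraction_id.
rewrite /M (le_trans (ler_sum _ (_ : forall i, _ -> _ <= E / q i + 1)))// ?lerDr// => i _.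
have : x t i ^+ 2 <= E / q i.
  rewrite ler_pdivlMr// mulrC (le_trans _ (xV t t0))// (bigD1 i)//= lerDl.
  by rewrite sumr_ge0// => l _; rewrite mulr_ge0 ?sqr_ge0 ?(ltW (q0 _)).
have := divr_ge0 E0 (ltW (q0 i)); set r := E / q i; move=> r0 xr.
rewrite -[leRHS]ger0_norm ?addr_ge0// -ler_sqr ?nnegrE//.
rewrite !real_normK ?num_real// (le_trans xr)//; nra.
Qed.

End Dissipative.

(** * A strict Lyapunov function for the error system *)

Section Lyapunov.
Context (R : realType).

Context (Ki D A m r l g c eta w0 i1 i2 u1 u2 : R).
Context (Ki0 : 0 < Ki) (D0 : 0 < D) (A0 : 0 < A) (r0 : 0 < r) (l0 : 0 < l)
  (g0 : 0 < g) (c0 : 0 < c).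

Implicit Types (a : 'I_6 -> R).

Local Notation o0 := (@Ordinal 6 0 isT).
Local Notation o1 := (@Ordinal 6 1 isT).
Local Notation o2 := (@Ordinal 6 2 isT).
Local Notation o3 := (@Ordinal 6 3 isT).
Local Notation o4 := (@Ordinal 6 4 isT).
Local Notation o5 := (@Ordinal 6 5 isT).

(** The closed loop in the deviations [a] from an equilibrium with AC current
    [(i1, i2)] and AC voltage [(u1, u2)].  Here [D] stands for [C_dc + K_d], [A] for
    [G_dc + K_p], [m] for [mu / 2], and [w0 + eta * a o1] is the actual frequency,
    [w0] being that of the equilibrium. *)
Definition error_field a : 'I_6 -> R := fun j => nth 0
  [:: a o1;
      (- A * a o1 - Ki * a o0 - m * a o3) / D;
      (- r * a o2 + (w0 + eta * a o1) * l * a o3 + eta * l * i2 * a o1 - a o4) / l;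
      (- r * a o3 - (w0 + eta * a o1) * l * a o2 - eta * l * i1 * a o1
        + m * a o1 - a o5) / l;
      (- g * a o4 + (w0 + eta * a o1) * c * a o5 + eta * c * u2 * a o1 + a o2) / c;
      (- g * a o5 - (w0 + eta * a o1) * c * a o4 - eta * c * u1 * a o1 + a o3) / c]
  j.

Definition energy_weight : 'I_6 -> R := fun j => nth 0 [:: Ki; D; l; l; c; c] j.

Lemma sum6 (h : 'I_6 -> R) :
  \sum_j h j = h o0 + h o1 + h o2 + h o3 + h o4 + h o5.
Proof.
rewrite !big_ord_recl big_ord0 addr0 !addrA.
by congr (h _ + h _ + h _ + h _ + h _ + h _); apply: val_inj.
Qed.

Lemma energy_weight_gt0 j : 0 < energy_weight j.
Proof. by case: j => -[|[|[|[|[|[|//]]]]]] ?. Qed.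

Lemma lipschitz_error_field j : lipschitz_on_boxes (fun a => error_field a j).
Proof.
have cst (k : R) := @lipschitz_on_boxes_cst R 'I_6 k.
have N h : lipschitz_on_boxes h -> lipschitz_on_boxes (fun a : 'I_6 -> R => - h a).
  move=> hL; have := lipschitz_on_boxesM (cst (-1)) hL.
  by under eq_fun do rewrite mulN1r.
by case: j => -[|[|[|[|[|[|//]]]]]] ?; rewrite /error_field/=;
  repeat (exact: cst || exact: lipschitz_on_boxes_coord || apply: N ||
          apply: lipschitz_on_boxesD || apply: lipschitz_on_boxesM).
Qed.

(** Rotations of the AC deviations drop out by skew symmetry, and so do the
    exchanges between integrator and DC side, between DC and AC sides, and between
    inductors and capacitors; what is left of the frequency is its deviation
    rotating the equilibrium. *)
Lemma energy_rateE a : \sum_j energy_weight j * a j * error_field a j =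
  - A * a o1 ^+ 2 - r * (a o2 ^+ 2 + a o3 ^+ 2) - g * (a o4 ^+ 2 + a o5 ^+ 2)
  + eta * a o1 * (l * (i2 * a o2 - i1 * a o3) + c * (u2 * a o4 - u1 * a o5)).
Proof.
by rewrite sum6 /energy_weight /error_field/=; field; rewrite !gt_eqF.
Qed.

Context (damped : eta ^+ 2 * (c ^+ 2 * (u1 ^+ 2 + u2 ^+ 2) / (4 * g)
  + l ^+ 2 * (i1 ^+ 2 + i2 ^+ 2) / (4 * r)) < A).

(** Each cross term [a o1 * a j] is absorbed by a fraction [k < 1] of the AC
    damping; by Young's inequality this costs [S / k * a o1 ^+ 2], which the DC
    damping [A] covers because [S < A]. *)
Lemma energy_rate_le : exists al be : R, [/\ 0 < al, 0 < be &
  forall a, \sum_j energy_weight j * a j * error_field a j <=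
    - al * a o1 ^+ 2 - be * (a o2 ^+ 2 + a o3 ^+ 2 + a o4 ^+ 2 + a o5 ^+ 2)].
Proof.
move: damped; set S := eta ^+ 2 * _ => SA.
have S0 : 0 <= S.
  by rewrite mulr_ge0 ?sqr_ge0// addr_ge0// divr_ge0 ?mulr_ge0 ?addr_ge0 ?sqr_ge0 ?ltW.
(* The midpoint of S / A and 1: then k < 1 and S / k < A. *)
pose k := (S + A) / (2 * A).
have k0 : 0 < k by rewrite divr_gt0 ?mulr_gt0// ltr_wpDl.
have k1 : k < 1 by rewrite ltr_pdivrMr ?mulr_gt0//; lra.
exists (A - S / k), ((1 - k) * Num.min r g); split.
- rewrite subr_gt0 ltr_pdivrMr// /k mulrA ltr_pdivlMr ?mulr_gt0//.
  have : S * A < A * A by rewrite ltr_pM2r.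
  lra.
- by rewrite mulr_gt0 ?subr_gt0// lt_min r0.
move=> a; rewrite energy_rateE.
have kr0 : 0 < k * r by rewrite mulr_gt0.
have kg0 : 0 < k * g by rewrite mulr_gt0.
have y2 := young (a o2) (eta * l * i2 * a o1) kr0.
have y3 := young (a o3) (- (eta * l * i1 * a o1)) kr0.
have y4 := young (a o4) (eta * c * u2 * a o1) kg0.
have y5 := young (a o5) (- (eta * c * u1 * a o1)) kg0.
have SE : S / k * a o1 ^+ 2 = (eta * l * i2 * a o1) ^+ 2 / (4 * (k * r))
  + (- (eta * l * i1 * a o1)) ^+ 2 / (4 * (k * r))
  + (eta * c * u2 * a o1) ^+ 2 / (4 * (k * g))
  + (- (eta * c * u1 * a o1)) ^+ 2 / (4 * (k * g)).
  by rewrite /S; field; rewrite !gt_eqF.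
have rm : Num.min r g <= r by rewrite ge_min lexx.
have gm : Num.min r g <= g by rewrite ge_min lexx orbT.
have k1' : 0 < 1 - k by rewrite subr_gt0.
have mr : (1 - k) * Num.min r g * (a o2 ^+ 2 + a o3 ^+ 2)
    <= (1 - k) * r * (a o2 ^+ 2 + a o3 ^+ 2).
  by rewrite ler_wpM2r ?addr_ge0 ?sqr_ge0// ler_wpM2l// ltW.
have mg : (1 - k) * Num.min r g * (a o4 ^+ 2 + a o5 ^+ 2)
    <= (1 - k) * g * (a o4 ^+ 2 + a o5 ^+ 2).
  by rewrite ler_wpM2r ?addr_ge0 ?sqr_ge0// ler_wpM2l// ltW.
rewrite !mulrBl !mul1r in mr mg *.
lra.
Qed.

Definition lyapunov (e : R) a : R :=
  (\sum_j energy_weight j * a j ^+ 2) / 2 + e * (D * (a o0 * a o1)).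

(** The derivative of [lyapunov e] at [a] in the direction [b]. *)
Definition lyapunov_rate (e : R) a b : R :=
  \sum_j energy_weight j * a j * b j + e * (D * (a o0 * b o1 + a o1 * b o0)).

(** Along the flow, the cross term contributes [- e * Ki * a o0 ^+ 2], which the rate
    of the energy lacks; all its other contributions are absorbed when its coefficient [e] is
    small. *)
Lemma exists_strict_lyapunov : exists e c1 c2 k : R,
  [/\ 0 < c1, 0 < k,
      forall a, c1 * \sum_j a j ^+ 2 <= lyapunov e a <= c2 * \sum_j a j ^+ 2
    & forall a, lyapunov_rate e a (error_field a) <= - k * lyapunov e a].
Proof.
have [al [be [al0 be0 rate]]] := energy_rate_le.
pose K1 := D + A ^+ 2 / Ki.
have K10 : 0 < K1 by rewrite addr_gt0// divr_gt0// exprn_gt0.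
pose K2 := 1 + m ^+ 2 / Ki.
have K20 : 0 < K2 by rewrite ltr_pwDl// divr_ge0 ?sqr_ge0 ?ltW.
pose e := Num.min (Num.min 1 (Ki / (4 * D))) (Num.min (al / (2 * K1)) (be / (2 * K2))).
have e0 : 0 < e by rewrite !lt_min ltr01 !divr_gt0 ?mulr_gt0.
have e1 : e <= 1 by rewrite !ge_min lexx.
have eD : e * D <= Ki / 4.
  have : e <= Ki / (4 * D) by rewrite !ge_min lexx !orbT.
  rewrite ler_pdivlMr ?mulr_gt0//; lra.
have eal : e * K1 <= al / 2.
  have : e <= al / (2 * K1) by rewrite !ge_min lexx !orbT.
  rewrite ler_pdivlMr ?mulr_gt0//; lra.
have ebe : e * K2 <= be / 2.
  have : e <= be / (2 * K2) by rewrite !ge_min lexx !orbT.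
  rewrite ler_pdivlMr ?mulr_gt0//; lra.
pose de := Num.min (e * Ki / 2) (Num.min (al / 2) (be / 2)).
have de0 : 0 < de by rewrite !lt_min !divr_gt0// mulr_gt0.
pose c1 := Num.min (Num.min (Ki / 4) (D / 4)) (Num.min (l / 2) (c / 2)).
have c10 : 0 < c1 by rewrite !lt_min !divr_gt0.
pose c2 := Ki + D + l + c.
have c20 : 0 < c2 by rewrite !addr_gt0.
have [k1 k2 k3 k4] : [/\ Ki <= c2, D <= c2, l <= c2 & c <= c2].
  by move: (Ki0) (D0) (l0) (c0); rewrite /c2 => ? ? ? ?; split; lra.
have cross a : `|e * (D * (a o0 * a o1))| <= Ki / 4 * a o0 ^+ 2 + D / 4 * a o1 ^+ 2.
  have D4 : 0 < D / 4 by rewrite divr_gt0.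
  have eeD : e ^+ 2 * D * a o0 ^+ 2 <= Ki / 4 * a o0 ^+ 2.
    rewrite ler_wpM2r ?sqr_ge0// (le_trans _ eD)// ler_wpM2r ?(ltW D0)//.
    by rewrite expr2 ler_piMl// ltW.
  have E : (e * D * a o0) ^+ 2 / (4 * (D / 4)) = e ^+ 2 * D * a o0 ^+ 2.
    by field; rewrite gt_eqF.
  have := young (a o1) (e * D * a o0) D4; have := young (a o1) (- (e * D * a o0)) D4.
  rewrite sqrrN E ler_norml; move=> ? ?; apply/andP; split; lra.
have sq a j : 0 <= a j ^+ 2 by exact: sqr_ge0.
have bounds a : c1 * \sum_j a j ^+ 2 <= lyapunov e a <= c2 * \sum_j a j ^+ 2.
  rewrite /lyapunov !sum6 /energy_weight/=.
  have := cross a; rewrite ler_norml => /andP[xl xu].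
  have wl j k : c1 <= k -> c1 * a j ^+ 2 <= k * a j ^+ 2.
    by move=> ck; rewrite ler_wpM2r.
  have wu j k : k <= c2 -> k * a j ^+ 2 <= c2 * a j ^+ 2.
    by move=> ck; rewrite ler_wpM2r.
  have h0 := wl o0 (Ki / 4); have h1 := wl o1 (D / 4); have h2 := wl o2 (l / 2).
  have h3 := wl o3 (l / 2); have h4 := wl o4 (c / 2); have h5 := wl o5 (c / 2).
  have H0 := wu o0 Ki; have H1 := wu o1 D; have H2 := wu o2 l.
  have H3 := wu o3 l; have H4 := wu o4 c; have H5 := wu o5 c.
  rewrite !ge_min !lexx !orbT/= in h0 h1 h2 h3 h4 h5.
  move: (h0 isT) (h1 isT) (h2 isT) (h3 isT) (h4 isT) (h5 isT).
  move=> {}h0 {}h1 {}h2 {}h3 {}h4 {}h5.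
  move: (H0 k1) (H1 k2) (H2 k3) (H3 k3) (H4 k4) (H5 k4).
  move=> {}H0 {}H1 {}H2 {}H3 {}H4 {}H5.
  have := mulr_ge0 (ltW Ki0) (sq a o0); have := mulr_ge0 (ltW D0) (sq a o1).
  have := mulr_ge0 (ltW l0) (sq a o2); have := mulr_ge0 (ltW l0) (sq a o3).
  have := mulr_ge0 (ltW c0) (sq a o4); have := mulr_ge0 (ltW c0) (sq a o5).
  move=> ? ? ? ? ? ?; apply/andP; split; lra.
exists e, c1, c2, (de / c2); split=> //; first by rewrite divr_gt0.
move=> a.
apply: (@le_trans _ _ (- de * \sum_j a j ^+ 2)); last first.
  have /andP[_ Wu] := bounds a.
  rewrite !mulNr lerN2 -mulrA ler_wpM2l ?(ltW de0)// ler_pdivrMl//.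
rewrite /lyapunov_rate; have := rate a.
set V' := \sum_j _ * _ * _ => V'le.
have -> : e * (D * (a o0 * error_field a o1 + a o1 * error_field a o0)) =
    e * (D * a o1 ^+ 2 - A * a o1 * a o0 - Ki * a o0 ^+ 2 - m * a o3 * a o0).
  by rewrite /error_field/=; field; rewrite gt_eqF.
have Ki4 : 0 < Ki / 4 by rewrite divr_gt0.
have y1 := young (a o0) (- (A * a o1)) Ki4.
have y3 := young (a o0) (- (m * a o3)) Ki4.
have E1 : (- (A * a o1)) ^+ 2 / (4 * (Ki / 4)) = A ^+ 2 / Ki * a o1 ^+ 2.
  by field; rewrite gt_eqF.
have E3 : (- (m * a o3)) ^+ 2 / (4 * (Ki / 4)) = m ^+ 2 / Ki * a o3 ^+ 2.
  by field; rewrite gt_eqF.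
rewrite E1 in y1; rewrite E3 in y3.
have Y : e * (D * a o1 ^+ 2 - A * a o1 * a o0 - Ki * a o0 ^+ 2 - m * a o3 * a o0)
    <= e * (K1 * a o1 ^+ 2 + K2 * a o3 ^+ 2 - Ki / 2 * a o0 ^+ 2).
  rewrite ler_wpM2l ?(ltW e0)//.
  have := sq a o3; rewrite /K1 /K2; lra.
have Y1 : e * K1 * a o1 ^+ 2 <= al / 2 * a o1 ^+ 2 by rewrite ler_wpM2r.
have Y3 : e * K2 * a o3 ^+ 2 <= be / 2 * a o3 ^+ 2 by rewrite ler_wpM2r.
have dl j k : de <= k -> de * a j ^+ 2 <= k * a j ^+ 2.
  by move=> ck; rewrite ler_wpM2r.
have d0 : de <= e * Ki / 2 by rewrite !ge_min lexx.
have d1 : de <= al / 2 by rewrite !ge_min lexx !orbT.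
have d2 : de <= be / 2 by rewrite !ge_min lexx !orbT.
have := dl o0 _ d0; have := dl o1 _ d1; have := dl o2 _ d2; have := dl o3 _ d2.
have := dl o4 _ d2; have := dl o5 _ d2.
have := mulr_ge0 (ltW be0) (sq a o2); have := mulr_ge0 (ltW be0) (sq a o4).
have := mulr_ge0 (ltW be0) (sq a o5).
rewrite sum6; lra.
Qed.

Lemma error_decay : exists C k : R, [/\ 0 <= C, 0 < k &
  forall x : R -> 'I_6 -> R,
    (forall j, {within `[0, +oo[, continuous (fun t => x t j)}) ->
    (forall (t : R) j, 0 < t -> is_derive t 1 (fun s => x s j) (error_field (x t) j)) ->
    forall t : R, 0 <= t ->
      \sum_j x t j ^+ 2 <= C * (\sum_j x 0 j ^+ 2) * expR (- k * t)].
Proof.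
have [e [c1 [c2 [k [c10 k0 bounds rate]]]]] := exists_strict_lyapunov.
exists (`|c2| / c1), k; split=> // [|x xc dx t t0]; first by rewrite divr_ge0// ltW.
have dW (s : R) : 0 < s -> is_derive s 1 (fun s => lyapunov e (x s))
    (lyapunov_rate e (x s) (error_field (x s))).
  move=> s0.
  have dj j : is_derive s 1 (fun s => x s j) (error_field (x s) j) by exact: dx.
  have dsum : is_derive s 1 (fun s => \sum_j energy_weight j * x s j ^+ 2)
      (\sum_j energy_weight j * (2 * x s j * error_field (x s) j)).
    apply: is_derive_sum_fin => j; have := dj j; set y := fun s => x s j => dy.
    have -> : (fun s => energy_weight j * x s j ^+ 2) =
        energy_weight j \*: (y ^+ 2) by [].
    apply: is_derive_eq; rewrite /GRing.scale/= /y; ring.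
  have d0 := dj o0; have d1 := dj o1; rewrite /lyapunov.
  set S := fun s => \sum_j _ in dsum *; set y0 := fun s => x s o0 in d0 *.
  set y1 := fun s => x s o1 in d1 *.
  have -> : (fun s => S s / 2 + e * (D * (y0 s * y1 s))) =
      2^-1 \*: S + (e * D) \*: (y0 * y1).
    by apply/funext => z; rewrite !fctE mulrA [S z / 2]mulrC.
  apply: is_derive_eq; rewrite /lyapunov_rate /GRing.scale/= -/(y0 s) -/(y1 s).
  rewrite mulr_sumr mulrA; congr (_ + _).
  by apply: eq_bigr => j _; field.
have Wc : {within `[0, +oo[, continuous (fun s => lyapunov e (x s))}.
  have kc (k' : R) : {within `[0, +oo[, continuous (fun _ : R => k')}.
    exact/continuous_subspaceT/cst_continuous.
  apply: within_continuousD; apply: within_continuousM => //; last first.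
    by apply: within_continuousM => //; apply: within_continuousM.
  apply: within_continuous_sum => j.
  by apply: within_continuousM => //; apply: within_continuousM.
have := exponential_decay Wc dW (fun s _ => rate (x s)) t0.
have /andP[Wl _] := bounds (x t); have /andP[_ Wu] := bounds (x 0) => We.
have c2le : c2 * (\sum_j x 0 j ^+ 2) <= `|c2| * \sum_j x 0 j ^+ 2.
  by rewrite ler_wpM2r ?ler_norm// sumr_ge0// => j _; exact: sqr_ge0.
rewrite -mulrA mulrAC ler_pdivlMr// mulrC (le_trans Wl)// (le_trans We)//.
by rewrite mulrA ler_wpM2r ?expR_ge0// (le_trans Wu).
Qed.

End Lyapunov.

(** * Complex numbers as plane matrices *)

Section PlaneVectors.
Context (R : realType).
Implicit Types (u v : 'cV[R]_2).

Lemma ord2P (i : 'I_2) : i = 0 \/ i = 1.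
Proof. by case: i => -[|[|//]] ?; [left | right]; apply: val_inj. Qed.

Lemma cV2P u v : u 0 0 = v 0 0 -> u 1 0 = v 1 0 -> u = v.
Proof. by move=> ? ?; apply/colP => i; case: (ord2P i) => ->. Qed.

Lemma sum2 (h : 'I_2 -> R) : \sum_j h j = h 0 + h 1.
Proof.
by rewrite !big_ord_recl big_ord0 addr0; congr (h _ + h _); apply: val_inj.
Qed.

Lemma euclid_norm2E u : euclid_norm u = Num.sqrt (u 0 0 ^+ 2 + u 1 0 ^+ 2).
Proof. by rewrite /euclid_norm sum2. Qed.

Lemma euclid_norm2_sqr u : euclid_norm u ^+ 2 = u 0 0 ^+ 2 + u 1 0 ^+ 2.
Proof. by rewrite euclid_norm2E sqr_sqrtr// addr_ge0 ?sqr_ge0. Qed.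

Lemma complex_mx_mul0 (a b : R) u :
  ((a%:M + b *: Jmx R) *m u) 0 0 = a * u 0 0 - b * u 1 0.
Proof. by rewrite !mxE sum2 !mxE/=; ring. Qed.

Lemma complex_mx_mul1 (a b : R) u :
  ((a%:M + b *: Jmx R) *m u) 1 0 = b * u 0 0 + a * u 1 0.
Proof. by rewrite !mxE sum2 !mxE/=; ring. Qed.

Lemma e2_mul u : ((e2 R)^T *m u) 0 0 = u 1 0.
Proof. by rewrite !mxE sum2 !mxE/=; ring. Qed.

(** Multiplication by [a + i b] scales every vector by the modulus, so the supremum
    is attained at every unit vector. *)
Lemma induced_norm_complex_mx (a b : R) :
  induced_norm (a%:M + b *: Jmx R) ^+ 2 = a ^+ 2 + b ^+ 2.
Proof.
have N0 : 0 <= a ^+ 2 + b ^+ 2 by rewrite addr_ge0 ?sqr_ge0.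
suff -> : induced_norm (a%:M + b *: Jmx R) = Num.sqrt (a ^+ 2 + b ^+ 2).
  by rewrite sqr_sqrtr.
have normE u : euclid_norm ((a%:M + b *: Jmx R) *m u)
    = Num.sqrt (a ^+ 2 + b ^+ 2) * euclid_norm u.
  rewrite !euclid_norm2E complex_mx_mul0 complex_mx_mul1 -sqrtrM//.
  by congr Num.sqrt; ring.
apply/eqP; rewrite eq_le; apply/andP; split.
  apply: ge_sup.
    by exists (euclid_norm ((a%:M + b *: Jmx R) *m 0)); exists 0 => //=;
      rewrite euclid_norm2E !mxE expr0n addr0 sqrtr0.
  by move=> _ [u /= u1 <-]; rewrite normE ler_piMr ?sqrtr_ge0.
apply: ub_le_sup.
  exists (Num.sqrt (a ^+ 2 + b ^+ 2)) => _ [u /= u1 <-].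
  by rewrite normE ler_piMr ?sqrtr_ge0.
have e1 : euclid_norm (e2 R) = 1.
  by rewrite euclid_norm2E !mxE/= expr0n expr1n add0r sqrtr1.
by exists (e2 R); rewrite /= ?normE e1 ?mulr1.
Qed.

End PlaneVectors.

(** * Equilibria and the modulation amplitude *)

Section Equilibrium.
Context (R : realType) (P : inverter R) (s : 'cV[R]_2) (r_ref mu : R).

Local Notation v := (v_dc_ref P).
Local Notation w := (omega0 P).
Local Notation Rr := (R_ac P).
Local Notation L := (L_ac P).
Local Notation G := (G_ac P).
Local Notation C := (C_ac P).

Definition ZY_re : R := Rr * G - w ^+ 2 * L * C + 1.
Definition ZY_im : R := w * L * G + w * C * Rr.

Lemma ZY_complex : Zmx P *m Ymx P + 1%:M = ZY_re%:M + ZY_im *: Jmx R.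
Proof.
apply/matrixP => i j; rewrite /Zmx /Ymx /ZY_re /ZY_im !mxE sum2 !mxE.
by case: (ord2P i) => ->; case: (ord2P j) => ->; rewrite /=; ring.
Qed.

Definition Zs0 : R := Rr * s 0 0 - w * L * s 1 0.
Definition Zs1 : R := w * L * s 0 0 + Rr * s 1 0.

Lemma psiE : psi P r_ref s =
  r_ref ^+ 2 * (ZY_re ^+ 2 + ZY_im ^+ 2) - (Zs0 ^+ 2 + Zs1 ^+ 2).
Proof.
by rewrite /psi ZY_complex induced_norm_complex_mx euclid_norm2_sqr
  complex_mx_mul0 complex_mx_mul1.
Qed.

(** The equation [|(mu / 2) v e2 - Z s| = r_ref |ZY + I|], squared. *)
Lemma mu_plus_quadratic : 0 < psi P r_ref s -> mu = mu_plus P r_ref s ->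
  mu ^+ 2 * v ^+ 2 / 4 - mu * v * Zs1 = psi P r_ref s.
Proof.
move=> psi0 ->; rewrite /mu_plus; set b := b_coef P s; set q := _ + _ / _.
have v0 := v_dc_ref_gt0 P.
have q0 : 0 <= q by rewrite addr_ge0 ?sqr_ge0// divr_ge0 ?sqr_ge0// mulr_ge0// ltW.
have bE : Zs1 = b * v / 4.
  rewrite /b /b_coef -mulmxA e2_mul complex_mx_mul1 -/Zs1.
  by field; rewrite gt_eqF.
have := sqr_sqrtr q0; set rt := Num.sqrt q => rtE.
have -> : (b / 2 + rt) ^+ 2 = b ^+ 2 / 4 + b * rt + rt ^+ 2 by field.
by rewrite rtE bE /q; field; rewrite gt_eqF.
Qed.

Definition closed_loop_coords (x0 x1 x2 x3 x4 x5 d0 d1 d2 d3 d4 d5 : R) : Prop :=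
  [/\ d0 = x1 - v,
      (C_dc P + K_d P) * d1 = - G_dc P * x1 + i_dc_ref P - K_p P * (x1 - v)
        - K_i P * x0 - mu / 2 * x3
    & [/\ L * d2 = - (Rr * x2 - x1 * Defs.eta P * L * x3) - x4,
      L * d3 = - (x1 * Defs.eta P * L * x2 + Rr * x3) + mu / 2 * x1 - x5,
      C * d4 = - (G * x4 - x1 * Defs.eta P * C * x5) - s 0 0 + x2
    & C * d5 = - (x1 * Defs.eta P * C * x4 + G * x5) - s 1 0 + x3]].

Lemma closed_loopE (x d : state R) : closed_loop P mu s x d <->
  closed_loop_coords x.1.1.1 x.1.1.2 (x.1.2 0 0) (x.1.2 1 0) (x.2 0 0) (x.2 1 0)
    d.1.1.1 d.1.1.2 (d.1.2 0 0) (d.1.2 1 0) (d.2 0 0) (d.2 1 0).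
Proof.
case: x => [[[x0 x1] i] u]; case: d => [[[d0 d1] di] du] /=.
rewrite e2_mul; split=> [[d0E d1E iE uE]|[d0E d1E [i0 i1 u0 u1]]].
  have entry (y z : 'cV[R]_2) : y = z -> y 0 0 = z 0 0 /\ y 1 0 = z 1 0 by move=> ->.
  have [i0 i1] := entry _ _ iE; have [u0 u1] := entry _ _ uE.
  move: i0 i1 u0 u1; rewrite !(complex_mx_mul0, complex_mx_mul1, mxE)/=.
  move=> i0 i1 u0 u1; split=> //; split.
  - by rewrite i0; ring.
  - by rewrite i1; ring.
  - by rewrite u0; ring.
  - by rewrite u1; ring.
split=> //; apply: cV2P; rewrite !(complex_mx_mul0, complex_mx_mul1, mxE)/=.
- by rewrite i0; ring.
- by rewrite i1; ring.
- by rewrite u0; ring.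
- by rewrite u1; ring.
Qed.

Lemma ZY_gt0 : 0 < r_ref -> 0 < psi P r_ref s -> 0 < ZY_re ^+ 2 + ZY_im ^+ 2.
Proof.
move=> r0; rewrite psiE subr_gt0 => psi0.
rewrite -(pmulr_rgt0 _ (exprn_gt0 2 r0)) (le_lt_trans _ psi0)//.
by rewrite addr_ge0 ?sqr_ge0.
Qed.

Lemma equilibriumE (x : state R) : is_equilibrium (closed_loop P mu s) x <->
  [/\ x.1.1.2 = v,
      ZY_re * x.2 0 0 - ZY_im * x.2 1 0 = - Zs0,
      ZY_im * x.2 0 0 + ZY_re * x.2 1 0 = mu / 2 * v - Zs1
    & [/\ x.1.2 0 0 = G * x.2 0 0 - w * C * x.2 1 0 + s 0 0,
      x.1.2 1 0 = w * C * x.2 0 0 + G * x.2 1 0 + s 1 0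
    & K_i P * x.1.1.1 = - G_dc P * v + i_dc_ref P - mu / 2 * x.1.2 1 0]].
Proof.
rewrite /is_equilibrium closed_loopE /closed_loop_coords /= !mxE !mulr0.
case: x => [[[x0 x1] i] u] /=; rewrite /ZY_re /ZY_im /Zs0 /Zs1.
have vE : v * Defs.eta P = w by rewrite /Defs.eta; field; rewrite gt_eqF ?v_dc_ref_gt0.
split=> [[x1E e1 [e2 e3 e4 e5]]|[-> e1 e2 [i0 i1 e3]]].
  have {}x1E : x1 = v by apply/eqP; rewrite -subr_eq0 -x1E.
  rewrite x1E vE in e1 e2 e3 e4 e5 *.
  have i0 : i 0 0 = G * u 0 0 - w * C * u 1 0 + s 0 0 by lra.
  have i1 : i 1 0 = w * C * u 0 0 + G * u 1 0 + s 1 0 by lra.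
  split=> //; last by split=> //; lra.
  - by rewrite i0 i1 in e2; lra.
  - by rewrite i0 i1 in e3; lra.
rewrite vE; split; [by rewrite subrr | by lra |].
by rewrite i0 i1; split; lra.
Qed.

Lemma equilibrium_unique (x y : state R) : 0 < ZY_re ^+ 2 + ZY_im ^+ 2 ->
  is_equilibrium (closed_loop P mu s) x ->
  is_equilibrium (closed_loop P mu s) y -> y = x.
Proof.
move=> N0 /equilibriumE + /equilibriumE.
case: x => [[[x0 x1] i] u]; case: y => [[[y0 y1] j] t] /=.
move=> [-> e1 e2 [i0 i1 e3]] [-> f1 f2 [j0 j1 f3]].
have cancelN (z : R) : (ZY_re ^+ 2 + ZY_im ^+ 2) * z = 0 -> z = 0.
  by move=> /eqP; rewrite mulf_eq0 gt_eqF//= => /eqP.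
have t0 : t 0 0 = u 0 0.
  apply/eqP; rewrite -subr_eq0; apply/eqP/cancelN.
  have -> : (ZY_re ^+ 2 + ZY_im ^+ 2) * (t 0 0 - u 0 0)
    = ZY_re * (ZY_re * t 0 0 - ZY_im * t 1 0) + ZY_im * (ZY_im * t 0 0 + ZY_re * t 1 0)
    - (ZY_re * (ZY_re * u 0 0 - ZY_im * u 1 0) + ZY_im * (ZY_im * u 0 0 + ZY_re * u 1 0)).
    by ring.
  by rewrite e1 e2 f1 f2 subrr.
have t1 : t 1 0 = u 1 0.
  apply/eqP; rewrite -subr_eq0; apply/eqP/cancelN.
  have -> : (ZY_re ^+ 2 + ZY_im ^+ 2) * (t 1 0 - u 1 0)
    = ZY_re * (ZY_im * t 0 0 + ZY_re * t 1 0) - ZY_im * (ZY_re * t 0 0 - ZY_im * t 1 0)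
    - (ZY_re * (ZY_im * u 0 0 + ZY_re * u 1 0) - ZY_im * (ZY_re * u 0 0 - ZY_im * u 1 0)).
    by ring.
  by rewrite e1 e2 f1 f2 subrr.
have -> : t = u by exact: cV2P.
have -> : j = i by apply: cV2P; rewrite ?j0 ?j1 ?i0 ?i1 t0 t1.
congr (_, _, _, _); apply: (mulfI (lt0r_neq0 (K_i_gt0 P))).
by rewrite f3 e3 j1 i1 t0 t1.
Qed.

Definition vec2 (a b : R) : 'cV[R]_2 := \col_i (if i == 0 then a else b).

Lemma exists_equilibrium : 0 < r_ref -> 0 < psi P r_ref s -> mu = mu_plus P r_ref s ->
  exists2 x : state R, is_equilibrium (closed_loop P mu s) x &
    x.1.1.2 = v /\ euclid_norm x.2 = r_ref.
Proof.
move=> r0 psi0 muE; have := mu_plus_quadratic psi0 muE.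
rewrite psiE => quad.
have N0 := ZY_gt0 r0 psi0.
set N := ZY_re ^+ 2 + ZY_im ^+ 2 in N0 quad.
pose p := - Zs0; pose q := mu / 2 * v - Zs1.
pose u := vec2 ((ZY_re * p + ZY_im * q) / N) ((ZY_re * q - ZY_im * p) / N).
pose i := vec2 (G * u 0 0 - w * C * u 1 0 + s 0 0) (w * C * u 0 0 + G * u 1 0 + s 1 0).
have u0 : u 0 0 = (ZY_re * p + ZY_im * q) / N by rewrite mxE.
have u1 : u 1 0 = (ZY_re * q - ZY_im * p) / N by rewrite mxE.
exists ((- G_dc P * v + i_dc_ref P - mu / 2 * i 1 0) / K_i P, v, i, u).
  apply/equilibriumE => /=; split=> //.
  - by rewrite u0 u1 /N -/p; field; rewrite gt_eqF.
  - by rewrite u0 u1 /N -/q; field; rewrite gt_eqF.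
  - split; rewrite ?[i _ _]mxE//=.
    by rewrite mulrC divfK// gt_eqF ?K_i_gt0.
split=> //=; rewrite euclid_norm2E -[RHS](ger0_norm (ltW r0)) -sqrtr_sqr.
congr Num.sqrt; rewrite u0 u1.
have -> : ((ZY_re * p + ZY_im * q) / N) ^+ 2 + ((ZY_re * q - ZY_im * p) / N) ^+ 2
    = (p ^+ 2 + q ^+ 2) / N by rewrite /N; field; rewrite gt_eqF.
have -> : p ^+ 2 + q ^+ 2 = r_ref ^+ 2 * N by rewrite /p /q; lra.
by rewrite mulfK// gt_eqF.
Qed.

End Equilibrium.

(** * Coordinates on the state space *)

Section Coordinates.
Context (R : realType).
Local Notation state := (state R).
Implicit Types (x y : state) (a : 'I_6 -> R).

Definition state_coord x : 'I_6 -> R := fun j => nth 0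
  [:: x.1.1.1; x.1.1.2; x.1.2 0 0; x.1.2 1 0; x.2 0 0; x.2 1 0] j.

Definition state_of_coords a : state :=
  (a (@Ordinal 6 0 isT), a (@Ordinal 6 1 isT),
   vec2 (a (@Ordinal 6 2 isT)) (a (@Ordinal 6 3 isT)),
   vec2 (a (@Ordinal 6 4 isT)) (a (@Ordinal 6 5 isT))).

Lemma state_coordK x : state_of_coords (state_coord x) = x.
Proof.
case: x => [[[x0 x1] i] u]; rewrite /state_of_coords /state_coord/=.
by congr (_, _, _, _); apply: cV2P; rewrite !mxE.
Qed.

Lemma state_of_coordsK a : state_coord (state_of_coords a) = a.
Proof.
apply/funext => -[[|[|[|[|[|[|//]]]]]] jlt]; rewrite /state_coord/= ?mxE/=;
  by congr a; apply: val_inj.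
Qed.

Lemma state_coordB x y j : state_coord (x - y) j = state_coord x j - state_coord y j.
Proof. by case: j => -[|[|[|[|[|[|//]]]]]] ?; rewrite /state_coord/= ?mxE. Qed.

Lemma state_coordZ (k : R) x j : state_coord (k *: x) j = k * state_coord x j.
Proof. by case: j => -[|[|[|[|[|[|//]]]]]] ?; rewrite /state_coord/= ?mxE. Qed.

Lemma norm_state_lt x (e : R) : 0 < e ->
  (`|x| < e <-> forall j, `|state_coord x j| < e).
Proof.
move=> e0; have cV (u : 'cV[R]_2) : `|u| < e <-> `|u 0 0| < e /\ `|u 1 0| < e.
  rewrite /Num.Def.normr/= mx_normrE; split.
    move=> /bigmax_ltP[_ ue]; split.
      exact: (ue (0, 0)).
    exact: (ue (1, 0)).
  move=> [u0 u1]; apply/bigmax_ltP; split=> // -[i j] _ /=.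
  by rewrite (ord1 j); case: (ord2P i) => ->.
case: x => [[[x0 x1] i] u]; rewrite !prod_normE/= !gt_max.
split=> [/andP[/andP[/andP[? ?] /cV[? ?]] /cV[? ?]]|xe].
  by case=> -[|[|[|[|[|[|//]]]]]] ?.
have xj n (n6 : (n < 6)%N) := xe (Ordinal n6).
rewrite (xj 0%N isT) (xj 1%N isT)/=; apply/andP; split; apply/cV; split.
- exact: (xj 2%N isT).
- exact: (xj 3%N isT).
- exact: (xj 4%N isT).
- exact: (xj 5%N isT).
Qed.

Lemma norm_coord_le x j : `|state_coord x j| <= `|x|.
Proof.
apply/ler_addgt0Pl => e e0; rewrite ltW//.
by apply: (norm_state_lt _ _).1; rewrite ?ltr_pwDl// ltrDr.
Qed.

Lemma cvg_state {T : Type} (F : set_system T) (FF : Filter F) (f : T -> state) x :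
  f @ F --> x <-> forall j, state_coord (f t) j @[t --> F] --> state_coord x j.
Proof.
split=> [fx j|fx]; apply/cvgrPdist_lt => e e0.
  move/cvgrPdist_lt : fx => /(_ e e0); apply: filterS => t.
  by move=> /(norm_state_lt _ e0) /(_ j); rewrite state_coordB.
have : \forall t \near F, forall j, `|state_coord x j - state_coord (f t) j| < e.
  apply: (@filter_forall _ _
    (fun j t => `|state_coord x j - state_coord (f t) j| < e)) => j.
  by move/cvgrPdist_lt : (fx j); exact.
by apply: filterS => t xt; apply/norm_state_lt => // j; rewrite state_coordB.
Qed.

(** As a limit of difference quotients, a derivative passes through coordinates by
    [cvg_state]. *)
Lemma is_derive_cvgP {V : normedModType R} (f : R -> V) (t : R) (d : V) :
  is_derive t 1 f d <-> h^-1 *: (f (h *: 1 + t) - f t) @[h --> 0^'] --> d.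
Proof.
split=> [[df <-]|fd]; first exact: df.
by split; [apply/cvg_ex; exists d | exact/cvg_lim].
Qed.

Lemma is_derive_state (f : R -> state) (t : R) (d : state) :
  is_derive t 1 f d <->
  forall j, is_derive t 1 (fun s => state_coord (f s) j) (state_coord d j).
Proof.
split=> [/is_derive_cvgP/cvg_state fd j|fd]; apply/is_derive_cvgP.
  by have := fd j; under eq_cvg do rewrite state_coordZ state_coordB.
apply/cvg_state => j; under eq_cvg do rewrite state_coordZ state_coordB.
exact/is_derive_cvgP.
Qed.

Lemma within_continuous_state (A : set R) (f : R -> state) :
  {within A, continuous f} <->
  forall j, {within A, continuous (fun t => state_coord (f t) j)}.
Proof.
split=> [fc j t|fc t].
  exact: (cvg_state _ _ _).1 (fc t) j.
by apply/cvg_state => j; exact: fc.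
Qed.

End Coordinates.

(** * Global asymptotic stability *)

Section GlobalStability.
Context (R : realType) (P : inverter R) (s : 'cV[R]_2) (mu : R) (xs : state R).
Context (xs_eq : is_equilibrium (closed_loop P mu s) xs).

Definition closed_loop_error : ('I_6 -> R) -> 'I_6 -> R :=
  error_field (K_i P) (C_dc P + K_d P) (G_dc P + K_p P) (mu / 2) (R_ac P) (L_ac P)
    (G_ac P) (C_ac P) (Defs.eta P) (omega0 P)
    (xs.1.2 0 0) (xs.1.2 1 0) (xs.2 0 0) (xs.2 1 0).

Lemma closed_loop_errorE (x d : state R) :
  closed_loop P mu s x d <-> state_coord d = closed_loop_error (state_coord (x - xs)).
Proof.
have vE : v_dc_ref P * Defs.eta P = omega0 P.
  by rewrite /Defs.eta; field; rewrite gt_eqF ?v_dc_ref_gt0.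
have D0 : C_dc P + K_d P != 0 by rewrite gt_eqF// addr_gt0 ?C_dc_gt0 ?K_d_gt0.
have L0 : L_ac P != 0 by rewrite gt_eqF// L_ac_gt0.
have C0 : C_ac P != 0 by rewrite gt_eqF// C_ac_gt0.
move: xs_eq; rewrite /is_equilibrium !closed_loopE /closed_loop_coords /= !mxE !mulr0.
rewrite /closed_loop_error.
case: (xs) => [[[z0 z1] j] t]; case: x => [[[x0 x1] i] u].
case: d => [[[d0 d1] di] du] /=.
move=> [z1E e1 [e2 e3 e4 e5]].
have {}z1E : z1 = v_dc_ref P by apply/eqP; rewrite -subr_eq0 -z1E.
rewrite z1E vE in e1 e2 e3 e4 e5 *.
split=> [[-> f1 [f2 f3 f4 f5]]|dE].
  apply/funext => -[[|[|[|[|[|[|//]]]]]] ?]; rewrite /state_coord /error_field/= ?mxE//.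
  - apply: (mulfI D0); rewrite f1 [RHS]mulrC divfK// -[LHS]subr0 e1 -?vE; ring.
  - apply: (mulfI L0); rewrite f2 [RHS]mulrC divfK// -[LHS]subr0 e2 -?vE; ring.
  - apply: (mulfI L0); rewrite f3 [RHS]mulrC divfK// -[LHS]subr0 e3 -?vE; ring.
  - apply: (mulfI C0); rewrite f4 [RHS]mulrC divfK// -[LHS]subr0 e4 -?vE; ring.
  - apply: (mulfI C0); rewrite f5 [RHS]mulrC divfK// -[LHS]subr0 e5 -?vE; ring.
have dj n (n6 : (n < 6)%N) := congr1 (fun h => h (Ordinal n6)) dE.
have := dj 0%N isT; have := dj 1%N isT; have := dj 2%N isT; have := dj 3%N isT.
have := dj 4%N isT; have := dj 5%N isT.
rewrite /state_coord /error_field/= !mxE => -> -> -> -> -> ->.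
split=> //; last split.
- rewrite [LHS]mulrC divfK// -[RHS]subr0 e1; ring.
- rewrite [LHS]mulrC divfK// -[RHS]subr0 e2 -?vE; ring.
- rewrite [LHS]mulrC divfK// -[RHS]subr0 e3 -?vE; ring.
- rewrite [LHS]mulrC divfK// -[RHS]subr0 e4 -?vE; ring.
- rewrite [LHS]mulrC divfK// -[RHS]subr0 e5 -?vE; ring.
Qed.

Lemma coord_solution (x : R -> state R) : is_solution (closed_loop P mu s) x <->
  (forall j, {within `[0, +oo[, continuous (fun t => state_coord (x t - xs) j)}) /\
  (forall (t : R) j, 0 < t -> is_derive t 1 (fun t => state_coord (x t - xs) j)
     (closed_loop_error (state_coord (x t - xs)) j)).
Proof.
have xsE j : (fun t => state_coord (x t - xs) j) =
    fun t => state_coord (x t) j - state_coord xs j.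
  by apply/funext => t; rewrite state_coordB.
have xE j : (fun t => state_coord (x t) j) =
    fun t => state_coord (x t - xs) j + state_coord xs j.
  by apply/funext => t; rewrite state_coordB subrK.
split=> [[xc dx]|[xc dx]].
  split=> [j|t j t0]; rewrite xsE.
    apply: within_continuousD; first exact: (within_continuous_state _ _).1 xc j.
    exact/continuous_subspaceT/cst_continuous.
  have [d /is_derive_state dxt /closed_loop_errorE <-] := dx t t0.
  have := dxt j; rewrite -[state_coord d j]subr0 => ?; exact: is_deriveB.
split=> [|t t0].
  apply/within_continuous_state => j; rewrite xE; apply: within_continuousD => //.
  exact/continuous_subspaceT/cst_continuous.
exists (state_of_coords (closed_loop_error (state_coord (x t - xs)))).
  apply/is_derive_state => j; rewrite state_of_coordsK xE -[closed_loop_error _ j]addr0.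
  have dxt := dx t j t0; exact: is_deriveD.
by apply/closed_loop_errorE; rewrite state_of_coordsK.
Qed.

Context (damped : damping_condition P xs).

Lemma damped_squares : Defs.eta P ^+ 2 *
    (C_ac P ^+ 2 * (xs.2 0 0 ^+ 2 + xs.2 1 0 ^+ 2) / (4 * G_ac P)
     + L_ac P ^+ 2 * (xs.1.2 0 0 ^+ 2 + xs.1.2 1 0 ^+ 2) / (4 * R_ac P))
    < G_dc P + K_p P.
Proof.
have eta0 : 0 < Defs.eta P by rewrite divr_gt0 ?omega0_gt0 ?v_dc_ref_gt0.
move: damped; rewrite /damping_condition; case: (xs) => [[[z0 z1] j] t] /=.
rewrite !euclid_norm2_sqr ltr_pdivlMr ?exprn_gt0// mulrC => /lt_trans; apply.
by rewrite ltrDl K_p_gt0.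
Qed.

Lemma closed_loop_error_decay : exists C k : R, [/\ 0 <= C, 0 < k &
  forall x, is_solution (closed_loop P mu s) x -> forall t : R, 0 <= t ->
    \sum_j state_coord (x t - xs) j ^+ 2
      <= C * (\sum_j state_coord (x 0 - xs) j ^+ 2) * expR (- k * t)].
Proof.
have D0 : 0 < C_dc P + K_d P by rewrite addr_gt0 ?C_dc_gt0 ?K_d_gt0.
have A0 : 0 < G_dc P + K_p P by rewrite addr_gt0 ?G_dc_gt0 ?K_p_gt0.
have [C [k [C0 k0 decay]]] := error_decay (mu / 2) (omega0 P) (K_i_gt0 P) D0 A0
  (R_ac_gt0 P) (L_ac_gt0 P) (G_ac_gt0 P) (C_ac_gt0 P) damped_squares.
exists C, k; split=> // x /coord_solution[xc dx]; exact: decay.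
Qed.

(** The bare energy suffices here: it is a diagonal form, as
    [dissipative_global_solution] requires, and it does not increase. *)
Lemma closed_loop_global_solution (x0 : state R) :
  exists x, is_solution (closed_loop P mu s) x /\ x 0 = x0.
Proof.
have D0 : 0 < C_dc P + K_d P by rewrite addr_gt0 ?C_dc_gt0 ?K_d_gt0.
have A0 : 0 < G_dc P + K_p P by rewrite addr_gt0 ?G_dc_gt0 ?K_p_gt0.
have [al [be [al0 be0 rate]]] := energy_rate_le (K_i P) (mu / 2) (omega0 P) D0 A0
  (R_ac_gt0 P) (L_ac_gt0 P) (G_ac_gt0 P) (C_ac_gt0 P) damped_squares.
pose q := energy_weight (K_i P) (C_dc P + K_d P) (L_ac P) (C_ac P).
have q0 : forall j, 0 < q j.
  exact: energy_weight_gt0 (K_i_gt0 P) D0 (L_ac_gt0 P) (C_ac_gt0 P).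
have errL j : lipschitz_on_boxes (fun a => closed_loop_error a j).
  exact: lipschitz_error_field.
have diss a : \sum_j q j * a j * closed_loop_error a j <= 0.
  apply: le_trans (rate a) _.
  by rewrite mulNr -opprD oppr_le0 addr_ge0// mulr_ge0 ?addr_ge0 ?sqr_ge0 ?ltW.
have [y [y0 dy]] := dissipative_global_solution (state_coord (x0 - xs)) q0 errL diss.
pose x t := state_of_coords (y t) + xs.
have xE t : state_coord (x t - xs) = y t by rewrite /x addrK state_of_coordsK.
exists x; split; last by rewrite /x y0 state_coordK subrK.
apply/coord_solution; split=> [j|t j t0].
  have -> : (fun t => state_coord (x t - xs) j) = fun t => y t j.
    by apply/funext => t; rewrite xE.
  exact: within_continuous_of_derive (fun t t0 => dy t j t0).
have -> : (fun t => state_coord (x t - xs) j) = fun t => y t j.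
  by apply/funext => z; rewrite xE.
by rewrite xE; exact: dy (ltW t0).
Qed.

Theorem closed_loop_stable :
  globally_asymptotically_stable (closed_loop P mu s) xs.
Proof.
have [C [k [C0 k0 decay]]] := closed_loop_error_decay.
have coord_le (x : state R) (e : R) : 0 < e ->
    \sum_j state_coord x j ^+ 2 < e ^+ 2 -> `|x| < e.
  move=> e0 xe; apply/norm_state_lt => // j.
  rewrite -(ltr_pXn2r (n := 2)) ?nnegrE ?(ltW e0)// real_normK ?num_real//.
  rewrite (le_lt_trans _ xe)// (bigD1 j)//= lerDl sumr_ge0// => i _.
  exact: sqr_ge0.
split; first exact: closed_loop_global_solution.
  (* There are six coordinates, and 6 * C < (6 * C + 1) ^ 2. *)
  move=> e e0; pose d := e / (6 * C + 1).
  have d1 : 0 < 6 * C + 1 by rewrite ltr_wpDl// mulr_ge0.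
  have d0 : 0 < d by rewrite divr_gt0.
  exists d => // x xsol xd t t0; apply: coord_le => //.
  apply: le_lt_trans (decay x xsol t t0) _.
  have S0 : \sum_j state_coord (x 0 - xs) j ^+ 2 <= 6 * d ^+ 2.
    have -> : 6 * d ^+ 2 = \sum_(j < 6) d ^+ 2 by rewrite sumr_const card_ord mulr_natl.
    apply: ler_sum => j _; rewrite -real_normK ?num_real//.
    rewrite ler_pXn2r ?nnegrE ?(ltW d0)//.
    exact: le_trans (norm_coord_le _ _) (ltW xd).
  apply: (@le_lt_trans _ _ (C * (6 * d ^+ 2))).
    apply: (@le_trans _ _ (C * (\sum_j state_coord (x 0 - xs) j ^+ 2))); last first.
      by rewrite ler_wpM2l.
    rewrite ler_piMr ?mulr_ge0 ?sumr_ge0// => [j _|]; first exact: sqr_ge0.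
    by rewrite -expR0 ler_expR mulNr oppr_le0 mulr_ge0// ltW.
  have eE : e = (6 * C + 1) * d by rewrite mulrC divfK// gt_eqF.
  rewrite eE (exprMn _ (6 * C + 1)) mulrA ltr_pM2r ?exprn_gt0//; nra.
move=> x xsol; apply/cvgrPdist_lt => e e0.
set S := \sum_j state_coord (x 0 - xs) j ^+ 2 in decay *.
have S0 : 0 <= S by rewrite sumr_ge0// => j _; exact: sqr_ge0.
have CS0 : 0 < C * S + 1 by rewrite ltr_wpDl// mulr_ge0.
have expk : expR (- (k * t)) @[t --> +oo] --> (0 : R).
  apply: (cvg_comp (fun t => k * t) (fun t => expR (- t)) _ (@cvgr_expR R)).
  by apply: gt0_cvgMry => //; exact: cvg_id.
have e2 : 0 < e ^+ 2 / (C * S + 1) by rewrite divr_gt0 ?exprn_gt0.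
move/cvgr0Pnorm_lt : expk => /(_ _ e2) expk; near=> t.
have t0 : 0 <= t by near: t; exact: nbhs_pinfty_ge.
rewrite distrC; apply: coord_le => //; apply: le_lt_trans (decay x xsol t t0) _.
have : `|expR (- (k * t))| < e ^+ 2 / (C * S + 1) by near: t.
rewrite gtr0_norm ?expR_gt0// ltr_pdivlMr// mulNr.
by apply: le_lt_trans; rewrite mulrC ler_pM2l ?expR_gt0// lerDl.
Unshelve. all: by end_near. Qed.

End GlobalStability.

Theorem corollary8 (R : realType) (P : inverter R) (s : 'cV[R]_2) (r_ref mu : R)
  (r_ref_gt0 : 0 < r_ref)
  (psi_gt0 : 0 < psi P r_ref s)
  (mu_def : mu = mu_plus P r_ref s)
  (damping : forall xs : state R,
     is_equilibrium (closed_loop P mu s) xs -> damping_condition P xs) :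
  exists xi v_dc i_dq v_dq, let xs : state R := (xi, v_dc, i_dq, v_dq) in
    [/\ is_equilibrium (closed_loop P mu s) xs,
        forall y : state R, is_equilibrium (closed_loop P mu s) y -> y = xs,
        v_dc = v_dc_ref P,
        euclid_norm v_dq = r_ref
      & globally_asymptotically_stable (closed_loop P mu s) xs].
Proof.
have [xs xs_eq [vE rE]] := exists_equilibrium r_ref_gt0 psi_gt0 mu_def.
have uniq y := equilibrium_unique (ZY_gt0 r_ref_gt0 psi_gt0) xs_eq (y := y).
have stable := closed_loop_stable xs_eq (damping xs xs_eq).
case: xs xs_eq vE rE uniq stable => [[[xi v_dc] i_dq] v_dq] /= xs_eq vE rE uniq stable.
by exists xi, v_dc, i_dq, v_dq; split.
Qed.
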